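(* Let $A$ be a Novikov algebra over $F$. The Jacobson radical of $A$ coincides with the intersection of the quasikernels of all irreducible right Novikov representations of $A$: $$\mathcal J(A)=\bigcap_{\rho}K_\rho(A),$$ where $\rho$ runs over all irreducible right Novikov representations of $A$.
   Context: $F$ is a field of characteristic different from $2$; all algebras are (not necessarily associative or unital) algebras over $F$. Write $(x,y,z)=(xy)z-x(yz)$. An algebra is a Novikov algebra if it satisfies the identities $(x,y,z)=(y,x,z)$ and $(xy)z=(xz)y$. Right modules. Let $\mathcal N_X$ be the free Novikov algebra over $F$ on countably many generators $X=\{x_1,x_2,\dots\}$. For a vector space $V$ let $T(V)$ be its tensor algebra; a linear map $\varphi:V\to B$ to a unital associative algebra $B$ induces the homomorphism $T(\varphi):T(V)\to B$, $1\mapsto 1$, $v_1\otimes\dots\otimes v_n\mapsto\varphi(v_1)\cdots\varphi(v_n)$. Endomorphisms act on the right: $m(\alpha\beta)=(m\alpha)\beta$. Let $R:\mathcal N_X\to\mathrm{End}(\mathcal N_X)$, $R(f)=R_f$, $gR_f=gf$. Elements of the kernel of $T(R):T(\mathcal N_X)\to\mathrm{End}(\mathcal N_X)$ are called R-identities. For $G(x_1,\dots,x_n)\in T(\mathcal N_X)$ and $a_1,\dots,a_n$ in a Novikov algebra $A$, $G(a_1,\dots,a_n)\in T(A)$ is obtained by substituting $a_i$ for $x_i$. A right (Novikov) representation of $A$ is a linear map $\rho:A\to\mathrm{End}(M)$, $M$ a vector space, such that $T(\rho)(G(a_1,\dots,a_n))=0$ for every R-identity $G$ and all $a_i\in A$.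 The space $M$ with the action $m\cdot a=m\rho(a)$ is then called a right (Novikov) $A$-module. A right $A$-module $M$ is irreducible if it has no nonzero proper submodules and $MA\neq 0$; the corresponding representation is then also called irreducible. The quasikernel $K_\rho(A)$ of a representation $\rho$ is the largest two-sided ideal of $A$ contained in the kernel $\mathrm{Ker}_\rho(A)=\{a\in A:\rho(a)=0\}$. Jacobson radical. $\mathcal J$ denotes the class of Novikov algebras over $F$ that have no irreducible right Novikov modules. This class is radical (in the Kurosh–Amitsur sense); in particular every Novikov algebra $A$ has a largest two-sided ideal $\mathcal J(A)$ which, as an algebra, belongs to $\mathcal J$. The ideal $\mathcal J(A)$ is called the Jacobson radical of $A$. The intersection of the empty family of ideals of $A$ is understood to be $A$. *)

(* Defs.v *)
From HB Require Import structures.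
From mathcomp Require Import all_boot all_order all_algebra.
From mathcomp Require Import generic_quotient.
From mathcomp Require Import boolp classical_sets.

Set Implicit Arguments.
Unset Strict Implicit.
Unset Printing Implicit Defensive.

Import GRing.Theory.
Local Open Scope ring_scope.
Local Open Scope quotient_scope.


HB.mixin Record Lmodule_isNovikov (F : fieldType) A of GRing.Lmodule F A := {
  nmul : A -> A -> A;
  nmul_linearl : forall y : A, linear (nmul^~ y);
  nmul_linearr : forall x : A, linear (nmul x);
  nmul_lsym : forall x y z : A,
    nmul (nmul x y) z - nmul x (nmul y z) =
    nmul (nmul y x) z - nmul y (nmul x z);
  nmul_rcomm : forall x y z : A, nmul (nmul x y) z = nmul (nmul x z) y
}.

#[short(type="novikovType")]
HB.structure Definition Novikov (F : fieldType) :=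
  {A of GRing.Lmodule F A & Lmodule_isNovikov F A}.

Notation "x ** y" := (nmul x y) (at level 40, left associativity)
  : ring_scope.

Section NovikovMul.
Variables (F : fieldType) (A : novikovType F).

Definition nmulr (y x : A) : A := x ** y.

HB.instance Definition _ (y : A) :=
  GRing.isLinear.Build F A A _ (nmulr y) (nmul_linearl y).
HB.instance Definition _ (x : A) :=
  GRing.isLinear.Build F A A _ (nmul x) (nmul_linearr x).

End NovikovMul.

(* MathComp's [algType F] requires 1 != 0, which fails for the endomorphism
   algebra of the zero space; the zero algebra is allowed here.  The product is
   not inherited from [pzRingType]: MathComp's hierarchy has no join of
   [pzRingType] and [lmodType F] below [lalgType F]. *)
HB.mixin Record Lmodule_isUnitalAssoc (F : fieldType) B
    of GRing.Lmodule F B := {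
  aone : B;
  amul : B -> B -> B;
  amulA : associative amul;
  amul1l : left_id aone amul;
  amul1r : right_id aone amul;
  amul_linearl : forall y : B, linear (amul^~ y);
  amul_linearr : forall x : B, linear (amul x)
}.

#[short(type="unitalAssocType")]
HB.structure Definition UnitalAssoc (F : fieldType) :=
  {B of GRing.Lmodule F B & Lmodule_isUnitalAssoc F B}.

Section UnitalAssocMul.
Variables (F : fieldType) (B : unitalAssocType F).

Definition amulr (y x : B) : B := amul x y.

HB.instance Definition _ (y : B) :=
  GRing.isLinear.Build F B B _ (amulr y) (amul_linearl y).
HB.instance Definition _ (x : B) :=
  GRing.isLinear.Build F B B _ (amul x) (amul_linearr x).

End UnitalAssocMul.

Section Endo.
Variables (F : fieldType) (M : lmodType F).

Definition endo := {linear M -> M}.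

HB.instance Definition _ := gen_eqMixin endo.
HB.instance Definition _ := gen_choiceMixin endo.

Implicit Types f g h : endo.

Lemma endo_eq f g : f =1 g -> f = g.
Proof.
case: f g => [f [[[f1 f2]] [f3]]] [g [[[g1 g2]] [g3]]] /= /funext fg; subst g.
by rewrite (Prop_irrelevance f1 g1) (Prop_irrelevance f2 g2)
  (Prop_irrelevance f3 g3).
Qed.

Fact endo0_linear : linear (fun _ : M => 0 : M).
Proof. by move=> c x y; rewrite scaler0 addr0. Qed.
Fact endo1_linear : linear (fun m : M => m).
Proof. by []. Qed.
Fact endoD_linear f g : linear (fun m : M => f m + g m).
Proof. by move=> c x y; rewrite !linearP scalerDr addrACA. Qed.
Fact endoN_linear f : linear (fun m : M => - f m).
Proof. by move=> c x y; rewrite linearP opprD scalerN. Qed.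
Fact endoZ_linear (c : F) f : linear (fun m : M => c *: f m).
Proof.
by move=> d x y; rewrite linearP scalerDr !scalerA mulrC.
Qed.
Fact endoM_linear f g : linear (fun m : M => g (f m)).
Proof. by move=> c x y; rewrite !linearP. Qed.

Definition mk_endo (f : M -> M) (lf : linear f) : endo :=
  HB.pack f (GRing.isLinear.Build F M M _ f lf).

Definition endo0 : endo := mk_endo endo0_linear.
Definition endo1 : endo := mk_endo endo1_linear.
Definition endoD f g : endo := mk_endo (endoD_linear f g).
Definition endoN f : endo := mk_endo (endoN_linear f).
Definition endoZ c f : endo := mk_endo (endoZ_linear c f).
(* Right action: the product f * g applies f first. *)
Definition endoM f g : endo := mk_endo (endoM_linear f g).

Fact endoDA : associative endoD.
Proof. by move=> f g h; apply: endo_eq => m /=; rewrite addrA. Qed.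
Fact endoDC : commutative endoD.
Proof. by move=> f g; apply: endo_eq => m /=; rewrite addrC. Qed.
Fact endo0D : left_id endo0 endoD.
Proof. by move=> f; apply: endo_eq => m /=; rewrite add0r. Qed.
Fact endoND : left_inverse endo0 endoN endoD.
Proof. by move=> f; apply: endo_eq => m /=; rewrite addNr. Qed.

HB.instance Definition _ := GRing.isZmodule.Build endo
  endoDA endoDC endo0D endoND.

Fact endoMA : associative endoM.
Proof. by move=> f g h; apply: endo_eq. Qed.
Fact endo1M : left_id endo1 endoM.
Proof. by move=> f; apply: endo_eq. Qed.
Fact endoM1 : right_id endo1 endoM.
Proof. by move=> f; apply: endo_eq. Qed.
Fact endoMDl : left_distributive endoM +%R.
Proof. by move=> f g h; apply: endo_eq => m /=; rewrite linearD. Qed.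
Fact endoMDr : right_distributive endoM +%R.
Proof. by move=> f g h; apply: endo_eq. Qed.

HB.instance Definition _ := GRing.Zmodule_isPzRing.Build endo
  endoMA endo1M endoM1 endoMDl endoMDr.

Fact endoZA c d f : endoZ c (endoZ d f) = endoZ (c * d) f.
Proof. by apply: endo_eq => m /=; rewrite scalerA. Qed.
Fact endoZ1 : left_id 1 endoZ.
Proof. by move=> f; apply: endo_eq => m /=; rewrite scale1r. Qed.
Fact endoZDr : right_distributive endoZ +%R.
Proof. by move=> c f g; apply: endo_eq => m /=; rewrite scalerDr. Qed.
Fact endoZDl f : {morph endoZ^~ f : c d / c + d}.
Proof. by move=> c d; apply: endo_eq => m /=; rewrite scalerDl. Qed.

HB.instance Definition _ := GRing.Zmodule_isLmodule.Build F endo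
  endoZA endoZ1 endoZDr endoZDl.

Fact endoM_linearl (g : endo) : linear (fun f : endo => f * g).
Proof. by move=> c f h; apply: endo_eq => m /=; rewrite linearP. Qed.
Fact endoM_linearr (f : endo) : linear (fun g : endo => f * g).
Proof. by move=> c g h; apply: endo_eq. Qed.

HB.instance Definition _ := Lmodule_isUnitalAssoc.Build F endo
  endoMA endo1M endoM1 endoM_linearl endoM_linearr.

Lemma endo_aoneE : aone = 1 :> endo. Proof. by []. Qed.
Lemma endo_amulE f g : amul f g = f * g :> endo. Proof. by []. Qed.
Lemma endo0E m : (0 : endo) m = 0. Proof. by []. Qed.
Lemma endo1E m : (1 : endo) m = m. Proof. by []. Qed.
Lemma endoDE f g m : (f + g) m = f m + g m. Proof. by []. Qed.
Lemma endoNE f m : (- f) m = - f m. Proof. by []. Qed.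
Lemma endoZE c f m : (c *: f) m = c *: f m. Proof. by []. Qed.
Lemma endoME f g m : (f * g) m = g (f m). Proof. by []. Qed.

End Endo.

(* Formal expressions modulo the least congruence that imposes the vector space
   axioms, bilinearity of the product, and the two Novikov identities. *)
Section FreeNovikov.
Variable F : fieldType.

Inductive nterm : Type :=
| NVar of nat
| NZero
| NAdd of nterm & nterm
| NScale of F & nterm
| NMul of nterm & nterm.

HB.instance Definition _ := gen_eqMixin nterm.
HB.instance Definition _ := gen_choiceMixin nterm.

Let nsub s t := NAdd s (NScale (-1) t).

Inductive ncong : nterm -> nterm -> Prop :=
| ncong_refl t : ncong t t
| ncong_sym s t : ncong s t -> ncong t s
| ncong_trans s t u : ncong s t -> ncong t u -> ncong s u
| ncong_add s s' t t' :
    ncong s s' -> ncong t t' -> ncong (NAdd s t) (NAdd s' t')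
| ncong_scale c t t' : ncong t t' -> ncong (NScale c t) (NScale c t')
| ncong_mul s s' t t' :
    ncong s s' -> ncong t t' -> ncong (NMul s t) (NMul s' t')
| ncong_addA s t u : ncong (NAdd s (NAdd t u)) (NAdd (NAdd s t) u)
| ncong_addC s t : ncong (NAdd s t) (NAdd t s)
| ncong_add0 t : ncong (NAdd NZero t) t
| ncong_addN t : ncong (NAdd (NScale (-1) t) t) NZero
| ncong_scaleA c d t : ncong (NScale c (NScale d t)) (NScale (c * d) t)
| ncong_scale1 t : ncong (NScale 1 t) t
| ncong_scaleDr c s t :
    ncong (NScale c (NAdd s t)) (NAdd (NScale c s) (NScale c t))
| ncong_scaleDl c d t :
    ncong (NScale (c + d) t) (NAdd (NScale c t) (NScale d t))
| ncong_mul_linl c s t u :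
    ncong (NMul (NAdd (NScale c s) t) u)
          (NAdd (NScale c (NMul s u)) (NMul t u))
| ncong_mul_linr c s t u :
    ncong (NMul u (NAdd (NScale c s) t))
          (NAdd (NScale c (NMul u s)) (NMul u t))
| ncong_lsym x y z :
    ncong (nsub (NMul (NMul x y) z) (NMul x (NMul y z)))
          (nsub (NMul (NMul y x) z) (NMul y (NMul x z)))
| ncong_rcomm x y z :
    ncong (NMul (NMul x y) z) (NMul (NMul x z) y).

Definition ncongb s t := `[< ncong s t >].

Fact ncongb_refl : reflexive ncongb.
Proof. by move=> t; apply/asboolP/ncong_refl. Qed.
Fact ncongb_sym : symmetric ncongb.
Proof. by move=> s t; apply/asboolP/asboolP; apply: ncong_sym. Qed.
Fact ncongb_trans : transitive ncongb.
Proof.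
move=> t s u /asboolP st /asboolP tu; apply/asboolP.
exact: ncong_trans st tu.
Qed.

Canonical ncong_equiv := EquivRel ncongb ncongb_refl ncongb_sym ncongb_trans.

Definition freeNovikov := {eq_quot ncong_equiv}.

HB.instance Definition _ := Choice.on freeNovikov.
HB.instance Definition _ := EqQuotient.on freeNovikov.

Definition npi (t : nterm) : freeNovikov := \pi_freeNovikov t.

Lemma npiP s t : npi s = npi t <-> ncong s t.
Proof.
split; first by move/eqquotP/asboolP.
by move=> st; apply/eqquotP/asboolP.
Qed.

Lemma npiK (x : freeNovikov) : npi (repr x) = x.
Proof. exact: reprK. Qed.

Lemma repr_npi t : ncong (repr (npi t)) t.
Proof. by apply/npiP; rewrite npiK. Qed.

Definition fn_zero : freeNovikov := npi NZero.
Definition fn_add (x y : freeNovikov) := npi (NAdd (repr x) (repr y)).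
Definition fn_scale c (x : freeNovikov) := npi (NScale c (repr x)).
Definition fn_opp := fn_scale (-1).
Definition fn_mul (x y : freeNovikov) := npi (NMul (repr x) (repr y)).

Lemma npi_add s t : npi (NAdd s t) = fn_add (npi s) (npi t).
Proof. by apply/npiP/ncong_sym/ncong_add; apply: repr_npi. Qed.
Lemma npi_scale c t : npi (NScale c t) = fn_scale c (npi t).
Proof. by apply/npiP/ncong_sym/ncong_scale/repr_npi. Qed.
Lemma npi_mul s t : npi (NMul s t) = fn_mul (npi s) (npi t).
Proof. by apply/npiP/ncong_sym/ncong_mul; apply: repr_npi. Qed.

Let npiE := (npi_add, npi_scale, npi_mul).

Lemma npi_ind (P : freeNovikov -> Prop) :
  (forall t, P (npi t)) -> forall x, P x.
Proof. by move=> Pt x; rewrite -(npiK x). Qed.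

Fact fn_addA : associative fn_add.
Proof.
elim/npi_ind=> s; elim/npi_ind=> t; elim/npi_ind=> u.
by rewrite -!npiE; apply/npiP/ncong_addA.
Qed.
Fact fn_addC : commutative fn_add.
Proof.
elim/npi_ind=> s; elim/npi_ind=> t.
by rewrite -!npiE; apply/npiP/ncong_addC.
Qed.
Fact fn_add0 : left_id fn_zero fn_add.
Proof. by elim/npi_ind=> t; rewrite -!npiE; apply/npiP/ncong_add0. Qed.
Fact fn_addN : left_inverse fn_zero fn_opp fn_add.
Proof.
by elim/npi_ind=> t; rewrite /fn_opp -!npiE; apply/npiP/ncong_addN.
Qed.

HB.instance Definition _ := GRing.isZmodule.Build freeNovikov
  fn_addA fn_addC fn_add0 fn_addN.

Fact fn_scaleA c d x : fn_scale c (fn_scale d x) = fn_scale (c * d) x.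
Proof. by elim/npi_ind: x=> t; rewrite -!npiE; apply/npiP/ncong_scaleA. Qed.
Fact fn_scale1 : left_id 1 fn_scale.
Proof. by elim/npi_ind=> t; rewrite -!npiE; apply/npiP/ncong_scale1. Qed.
Fact fn_scaleDr : right_distributive fn_scale +%R.
Proof.
move=> c; elim/npi_ind=> s; elim/npi_ind=> t.
rewrite -[_ + _]/(fn_add _ _) -[RHS]/(fn_add _ _).
by rewrite -!npiE; apply/npiP/ncong_scaleDr.
Qed.
Fact fn_scaleDl x : {morph fn_scale^~ x : c d / c + d}.
Proof.
elim/npi_ind: x => t c d; rewrite -[RHS]/(fn_add _ _).
by rewrite -!npiE; apply/npiP/ncong_scaleDl.
Qed.

HB.instance Definition _ := GRing.Zmodule_isLmodule.Build F freeNovikov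
  fn_scaleA fn_scale1 fn_scaleDr fn_scaleDl.

Lemma npiD s t : npi (NAdd s t) = npi s + npi t.
Proof. exact: npi_add. Qed.
Lemma npiZ c t : npi (NScale c t) = c *: npi t.
Proof. exact: npi_scale. Qed.
Lemma npi0 : npi NZero = 0. Proof. by []. Qed.

Fact fn_mul_linl y : linear (fn_mul^~ y).
Proof.
elim/npi_ind: y => u c; elim/npi_ind=> s; elim/npi_ind=> t.
rewrite /= -npiZ -npiD -!npi_mul -npiZ -npiD.
exact/npiP/ncong_mul_linl.
Qed.
Fact fn_mul_linr x : linear (fn_mul x).
Proof.
elim/npi_ind: x => u c; elim/npi_ind=> s; elim/npi_ind=> t.
rewrite /= -npiZ -npiD -!npi_mul -npiZ -npiD.
exact/npiP/ncong_mul_linr.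
Qed.
Fact fn_mul_lsym x y z :
  fn_mul (fn_mul x y) z - fn_mul x (fn_mul y z) =
  fn_mul (fn_mul y x) z - fn_mul y (fn_mul x z).
Proof.
elim/npi_ind: x => x; elim/npi_ind: y => y; elim/npi_ind: z => z.
rewrite -!npi_mul -!scaleN1r -!npiZ -!npiD.
exact/npiP/ncong_lsym.
Qed.
Fact fn_mul_rcomm x y z : fn_mul (fn_mul x y) z = fn_mul (fn_mul x z) y.
Proof.
elim/npi_ind: x => x; elim/npi_ind: y => y; elim/npi_ind: z => z.
by rewrite -!npi_mul; apply/npiP/ncong_rcomm.
Qed.

HB.instance Definition _ := Lmodule_isNovikov.Build F freeNovikov
  fn_mul_linl fn_mul_linr fn_mul_lsym fn_mul_rcomm.

Lemma npiM s t : npi (NMul s t) = npi s ** npi t.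
Proof. exact: npi_mul. Qed.

Definition nvar (i : nat) : freeNovikov := npi (NVar i).

Section Eval.
Variables (A : novikovType F) (a : nat -> A).

Fixpoint nterm_eval (t : nterm) : A :=
  match t with
  | NVar i => a i
  | NZero => 0
  | NAdd s t => nterm_eval s + nterm_eval t
  | NScale c t => c *: nterm_eval t
  | NMul s t => nterm_eval s ** nterm_eval t
  end.

Lemma nterm_eval_cong s t : ncong s t -> nterm_eval s = nterm_eval t.
Proof.
elim=> {s t} //=; try congruence.
- by move=> s t u; rewrite addrA.
- by move=> s t; rewrite addrC.
- by move=> t; rewrite add0r.
- by move=> t; rewrite scaleN1r addNr.
- by move=> c d t; rewrite scalerA.
- by move=> t; rewrite scale1r.
- by move=> c s t; rewrite scalerDr.
- by move=> c d t; rewrite scalerDl.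
- by move=> c s t u; rewrite nmul_linearl.
- by move=> c s t u; rewrite nmul_linearr.
- by move=> x y z; rewrite !scaleN1r nmul_lsym.
- by move=> x y z; rewrite nmul_rcomm.
Qed.

(* The homomorphism x_i |-> a_i. *)
Definition nsubst (x : freeNovikov) : A := nterm_eval (repr x).

Lemma nsubst_npi t : nsubst (npi t) = nterm_eval t.
Proof. exact/nterm_eval_cong/repr_npi. Qed.

Fact nsubst_linear : linear nsubst.
Proof.
move=> c; elim/npi_ind=> s; elim/npi_ind=> t.
by rewrite -npiZ -npiD !nsubst_npi.
Qed.

HB.instance Definition _ :=
  GRing.isLinear.Build F freeNovikov A _ nsubst nsubst_linear.

Lemma nsubstM x y : nsubst (x ** y) = nsubst x ** nsubst y.
Proof.
elim/npi_ind: x => s; elim/npi_ind: y => t.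
by rewrite -npiM !nsubst_npi.
Qed.

Lemma nsubst_var i : nsubst (nvar i) = a i.
Proof. exact: nsubst_npi. Qed.

Lemma nsubst_unique (f : {linear freeNovikov -> A}) :
    (forall x y, f (x ** y) = f x ** f y) -> (forall i, f (nvar i) = a i) ->
  f =1 nsubst.
Proof.
move=> fM fx; elim/npi_ind; elim=> [i||s IHs t IHt|c t IHt|s IHs t IHt].
- by rewrite nsubst_var fx.
- by rewrite !linear0.
- by rewrite npiD !linearD IHs IHt.
- by rewrite npiZ !linearZ /= IHt.
- by rewrite npiM fM nsubstM IHs IHt.
Qed.

End Eval.

End FreeNovikov.

(* Formal expressions in the vectors of V modulo the least congruence that
   imposes the axioms of a unital associative algebra and linearity of the
   embedding of V. *)
Section Tensor.
Variables (F : fieldType) (V : lmodType F).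

Inductive tterm : Type :=
| TIn of V
| TZero
| TOne
| TAdd of tterm & tterm
| TScale of F & tterm
| TMul of tterm & tterm.

HB.instance Definition _ := gen_eqMixin tterm.
HB.instance Definition _ := gen_choiceMixin tterm.

Inductive tcong : tterm -> tterm -> Prop :=
| tcong_refl t : tcong t t
| tcong_sym s t : tcong s t -> tcong t s
| tcong_trans s t u : tcong s t -> tcong t u -> tcong s u
| tcong_add s s' t t' :
    tcong s s' -> tcong t t' -> tcong (TAdd s t) (TAdd s' t')
| tcong_scale c t t' : tcong t t' -> tcong (TScale c t) (TScale c t')
| tcong_mul s s' t t' :
    tcong s s' -> tcong t t' -> tcong (TMul s t) (TMul s' t')
| tcong_addA s t u : tcong (TAdd s (TAdd t u)) (TAdd (TAdd s t) u)
| tcong_addC s t : tcong (TAdd s t) (TAdd t s)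
| tcong_add0 t : tcong (TAdd TZero t) t
| tcong_addN t : tcong (TAdd (TScale (-1) t) t) TZero
| tcong_scaleA c d t : tcong (TScale c (TScale d t)) (TScale (c * d) t)
| tcong_scale1 t : tcong (TScale 1 t) t
| tcong_scaleDr c s t :
    tcong (TScale c (TAdd s t)) (TAdd (TScale c s) (TScale c t))
| tcong_scaleDl c d t :
    tcong (TScale (c + d) t) (TAdd (TScale c t) (TScale d t))
| tcong_mulA s t u : tcong (TMul s (TMul t u)) (TMul (TMul s t) u)
| tcong_mul1l t : tcong (TMul TOne t) t
| tcong_mul1r t : tcong (TMul t TOne) t
| tcong_mulDl s t u : tcong (TMul (TAdd s t) u) (TAdd (TMul s u) (TMul t u))
| tcong_mulDr s t u : tcong (TMul s (TAdd t u)) (TAdd (TMul s t) (TMul s u))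
| tcong_scaleAl c s t : tcong (TScale c (TMul s t)) (TMul (TScale c s) t)
| tcong_scaleAr c s t : tcong (TScale c (TMul s t)) (TMul s (TScale c t))
| tcong_lin c u v :
    tcong (TIn (c *: u + v)) (TAdd (TScale c (TIn u)) (TIn v)).

Definition tcongb s t := `[< tcong s t >].

Fact tcongb_refl : reflexive tcongb.
Proof. by move=> t; apply/asboolP/tcong_refl. Qed.
Fact tcongb_sym : symmetric tcongb.
Proof. by move=> s t; apply/asboolP/asboolP; apply: tcong_sym. Qed.
Fact tcongb_trans : transitive tcongb.
Proof.
move=> t s u /asboolP st /asboolP tu; apply/asboolP.
exact: tcong_trans st tu.
Qed.

Canonical tcong_equiv := EquivRel tcongb tcongb_refl tcongb_sym tcongb_trans.

Definition tensor := {eq_quot tcong_equiv}.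

HB.instance Definition _ := Choice.on tensor.
HB.instance Definition _ := EqQuotient.on tensor.

Definition tpi (t : tterm) : tensor := \pi_tensor t.

Lemma tpiP s t : tpi s = tpi t <-> tcong s t.
Proof.
split; first by move/eqquotP/asboolP.
by move=> st; apply/eqquotP/asboolP.
Qed.

Lemma tpiK (x : tensor) : tpi (repr x) = x.
Proof. exact: reprK. Qed.

Lemma repr_tpi t : tcong (repr (tpi t)) t.
Proof. by apply/tpiP; rewrite tpiK. Qed.

Definition ts_zero : tensor := tpi TZero.
Definition ts_one : tensor := tpi TOne.
Definition ts_add (x y : tensor) := tpi (TAdd (repr x) (repr y)).
Definition ts_scale c (x : tensor) := tpi (TScale c (repr x)).
Definition ts_opp := ts_scale (-1).
Definition ts_mul (x y : tensor) := tpi (TMul (repr x) (repr y)).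

Lemma tpi_add s t : tpi (TAdd s t) = ts_add (tpi s) (tpi t).
Proof. by apply/tpiP/tcong_sym/tcong_add; apply: repr_tpi. Qed.
Lemma tpi_scale c t : tpi (TScale c t) = ts_scale c (tpi t).
Proof. by apply/tpiP/tcong_sym/tcong_scale/repr_tpi. Qed.
Lemma tpi_mul s t : tpi (TMul s t) = ts_mul (tpi s) (tpi t).
Proof. by apply/tpiP/tcong_sym/tcong_mul; apply: repr_tpi. Qed.

Let tpiE := (tpi_add, tpi_scale, tpi_mul).

Lemma tpi_ind (P : tensor -> Prop) : (forall t, P (tpi t)) -> forall x, P x.
Proof. by move=> Pt x; rewrite -(tpiK x). Qed.

Fact ts_addA : associative ts_add.
Proof.
elim/tpi_ind=> s; elim/tpi_ind=> t; elim/tpi_ind=> u.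
by rewrite -!tpiE; apply/tpiP/tcong_addA.
Qed.
Fact ts_addC : commutative ts_add.
Proof.
elim/tpi_ind=> s; elim/tpi_ind=> t.
by rewrite -!tpiE; apply/tpiP/tcong_addC.
Qed.
Fact ts_add0 : left_id ts_zero ts_add.
Proof. by elim/tpi_ind=> t; rewrite -!tpiE; apply/tpiP/tcong_add0. Qed.
Fact ts_addN : left_inverse ts_zero ts_opp ts_add.
Proof.
by elim/tpi_ind=> t; rewrite /ts_opp -!tpiE; apply/tpiP/tcong_addN.
Qed.

HB.instance Definition _ := GRing.isZmodule.Build tensor
  ts_addA ts_addC ts_add0 ts_addN.

Lemma tpiD s t : tpi (TAdd s t) = tpi s + tpi t.
Proof. exact: tpi_add. Qed.
Lemma tpi0 : tpi TZero = 0. Proof. by []. Qed.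

Fact ts_mulA : associative ts_mul.
Proof.
elim/tpi_ind=> s; elim/tpi_ind=> t; elim/tpi_ind=> u.
by rewrite -!tpiE; apply/tpiP/tcong_mulA.
Qed.
Fact ts_mul1l : left_id ts_one ts_mul.
Proof. by elim/tpi_ind=> t; rewrite -!tpiE; apply/tpiP/tcong_mul1l. Qed.
Fact ts_mul1r : right_id ts_one ts_mul.
Proof. by elim/tpi_ind=> t; rewrite -!tpiE; apply/tpiP/tcong_mul1r. Qed.
Fact ts_mulDl : left_distributive ts_mul +%R.
Proof.
elim/tpi_ind=> s; elim/tpi_ind=> t; elim/tpi_ind=> u.
by rewrite -!(tpiD, tpi_mul); apply/tpiP/tcong_mulDl.
Qed.
Fact ts_mulDr : right_distributive ts_mul +%R.
Proof.
elim/tpi_ind=> s; elim/tpi_ind=> t; elim/tpi_ind=> u.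
by rewrite -!(tpiD, tpi_mul); apply/tpiP/tcong_mulDr.
Qed.

HB.instance Definition _ := GRing.Zmodule_isPzRing.Build tensor
  ts_mulA ts_mul1l ts_mul1r ts_mulDl ts_mulDr.

Fact ts_scaleA c d x : ts_scale c (ts_scale d x) = ts_scale (c * d) x.
Proof. by elim/tpi_ind: x=> t; rewrite -!tpiE; apply/tpiP/tcong_scaleA. Qed.
Fact ts_scale1 : left_id 1 ts_scale.
Proof. by elim/tpi_ind=> t; rewrite -!tpiE; apply/tpiP/tcong_scale1. Qed.
Fact ts_scaleDr : right_distributive ts_scale +%R.
Proof.
move=> c; elim/tpi_ind=> s; elim/tpi_ind=> t.
by rewrite -!(tpiD, tpi_scale); apply/tpiP/tcong_scaleDr.
Qed.
Fact ts_scaleDl x : {morph ts_scale^~ x : c d / c + d}.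
Proof.
elim/tpi_ind: x => t c d.
by rewrite -!(tpiD, tpi_scale); apply/tpiP/tcong_scaleDl.
Qed.

HB.instance Definition _ := GRing.Zmodule_isLmodule.Build F tensor
  ts_scaleA ts_scale1 ts_scaleDr ts_scaleDl.

Lemma tpiZ c t : tpi (TScale c t) = c *: tpi t.
Proof. exact: tpi_scale. Qed.
Lemma tpiM s t : tpi (TMul s t) = tpi s * tpi t.
Proof. exact: tpi_mul. Qed.
Lemma tpi1 : tpi TOne = 1. Proof. by []. Qed.

Fact ts_scalerAl (c : F) (x y : tensor) : c *: (x * y) = (c *: x) * y.
Proof.
elim/tpi_ind: x => s; elim/tpi_ind: y => t.
by rewrite -!(tpiM, tpiZ); apply/tpiP/tcong_scaleAl.
Qed.
Fact ts_scalerAr (c : F) (x y : tensor) : c *: (x * y) = x * (c *: y).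
Proof.
elim/tpi_ind: x => s; elim/tpi_ind: y => t.
by rewrite -!(tpiM, tpiZ); apply/tpiP/tcong_scaleAr.
Qed.

Fact ts_mul_linearl (y : tensor) : linear (fun x : tensor => x * y).
Proof. by move=> c x z; rewrite mulrDl ts_scalerAl. Qed.
Fact ts_mul_linearr (x : tensor) : linear (fun y : tensor => x * y).
Proof. by move=> c y z; rewrite mulrDr ts_scalerAr. Qed.

HB.instance Definition _ := Lmodule_isUnitalAssoc.Build F tensor
  ts_mulA ts_mul1l ts_mul1r ts_mul_linearl ts_mul_linearr.

Lemma tensor_aoneE : aone = 1 :> tensor. Proof. by []. Qed.
Lemma tensor_amulE (x y : tensor) : amul x y = x * y. Proof. by []. Qed.

Definition tin (v : V) : tensor := tpi (TIn v).

Fact tin_linear : linear tin.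
Proof. by move=> c u v; rewrite /tin -tpiZ -tpiD; apply/tpiP/tcong_lin. Qed.

HB.instance Definition _ := GRing.isLinear.Build F V tensor _ tin tin_linear.

Section Lift.
Variables (B : unitalAssocType F) (phi : {linear V -> B}).

Fixpoint tterm_eval (t : tterm) : B :=
  match t with
  | TIn v => phi v
  | TZero => 0
  | TOne => aone
  | TAdd s t => tterm_eval s + tterm_eval t
  | TScale c t => c *: tterm_eval t
  | TMul s t => amul (tterm_eval s) (tterm_eval t)
  end.

Lemma tterm_eval_cong s t : tcong s t -> tterm_eval s = tterm_eval t.
Proof.
elim=> {s t} //=; try congruence.
- by move=> s t u; rewrite addrA.
- by move=> s t; rewrite addrC.
- by move=> t; rewrite add0r.
- by move=> t; rewrite scaleN1r addNr.
- by move=> c d t; rewrite scalerA.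
- by move=> t; rewrite scale1r.
- by move=> c s t; rewrite scalerDr.
- by move=> c d t; rewrite scalerDl.
- by move=> s t u; rewrite amulA.
- by move=> t; rewrite amul1l.
- by move=> t; rewrite amul1r.
- by move=> s t u; exact: (linearD (amulr _)).
- by move=> s t u; rewrite linearD.
- by move=> c s t; exact: esym (linearZZ (amulr _) _ _).
- by move=> c s t; rewrite -linearZ.
- by move=> c u v; rewrite linearP.
Qed.

(* T(phi) *)
Definition tlift (x : tensor) : B := tterm_eval (repr x).

Lemma tlift_tpi t : tlift (tpi t) = tterm_eval t.
Proof. exact/tterm_eval_cong/repr_tpi. Qed.

Fact tlift_linear : linear tlift.
Proof.
move=> c; elim/tpi_ind=> s; elim/tpi_ind=> t.
by rewrite -tpiZ -tpiD !tlift_tpi.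
Qed.

HB.instance Definition _ :=
  GRing.isLinear.Build F tensor B _ tlift tlift_linear.

Lemma tlift1 : tlift 1 = aone.
Proof. exact: tlift_tpi. Qed.

Lemma tliftM x y : tlift (x * y) = amul (tlift x) (tlift y).
Proof.
elim/tpi_ind: x => s; elim/tpi_ind: y => t.
by rewrite -tpiM !tlift_tpi.
Qed.

Lemma tlift_in v : tlift (tin v) = phi v.
Proof. exact: tlift_tpi. Qed.

Lemma tlift_prod (vs : seq V) :
  tlift (\prod_(v <- vs) tin v) = \big[amul/aone]_(v <- vs) phi v.
Proof.
elim: vs => [|v vs IHvs]; first by rewrite !big_nil tlift1.
by rewrite !big_cons tliftM tlift_in IHvs.
Qed.

Lemma tlift_unique (f : {linear tensor -> B}) :
    f 1 = aone -> (forall x y, f (x * y) = amul (f x) (f y)) ->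
    (forall v, f (tin v) = phi v) ->
  f =1 tlift.
Proof.
move=> f1 fM fv; elim/tpi_ind; elim=> [v|||s IHs t IHt|c t IHt|s IHs t IHt].
- by rewrite tlift_in fv.
- by rewrite !linear0.
- by rewrite f1 tlift1.
- by rewrite tpiD !linearD IHs IHt.
- by rewrite tpiZ !linearZ /= IHt.
- by rewrite tpiM fM tliftM IHs IHt.
Qed.

End Lift.

End Tensor.

Section RightMultiplication.
Variables (F : fieldType) (A : novikovType F).

Definition rmult (f : A) : endo A := nmulr f.

Fact rmult_linear : linear rmult.
Proof. by move=> c f g; apply: endo_eq => h; apply: nmul_linearr. Qed.

HB.instance Definition _ := GRing.isLinear.Build F A (endo A) _ rmult
  rmult_linear.

End RightMultiplication.

Definition R_identity (F : fieldType) (G : tensor (freeNovikov F)) : Prop :=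
  tlift (@rmult F (freeNovikov F)) G = 0.

(* G(a_0, a_1, ...); only the generators occurring in G matter. *)
Definition tsubst (F : fieldType) (A : novikovType F) (a : nat -> A)
    (G : tensor (freeNovikov F)) : tensor A :=
  tlift (@tin F A \o nsubst a) G.

Section Representations.
Variables (F : fieldType) (A : novikovType F) (M : lmodType F).
Variable rho : {linear A -> endo M}.

Definition right_novikov_rep : Prop :=
  forall G : tensor (freeNovikov F), R_identity G ->
  forall a : nat -> A, tlift rho (tsubst a G) = 0.

Definition submodule (N : set M) : Prop :=
  [/\ N 0,
      forall c x y, N x -> N y -> N (c *: x + y) &
      forall x a, N x -> N (rho a x)].

Definition irreducible_rep : Prop :=
  [/\ right_novikov_rep,
      forall N : set M, submodule N -> N = [set 0]%classic \/ N = setT%classic &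
      exists m a, rho a m != 0].

Definition rep_ker : set A := [set a | rho a = 0]%classic.

End Representations.

Record ideal (F : fieldType) (A : novikovType F) := Ideal {
  ideal_set :> set A;
  ideal0 : ideal_set 0;
  idealP : forall (c : F) x y,
    ideal_set x -> ideal_set y -> ideal_set (c *: x + y);
  ideal_mull : forall a x, ideal_set x -> ideal_set (a ** x);
  ideal_mulr : forall x a, ideal_set x -> ideal_set (x ** a)
}.

Section IdealAlgebra.
Variables (F : fieldType) (A : novikovType F) (I : ideal A).

Definition ideal_pred : {pred A} := fun x => `[< ideal_set I x >].

Fact ideal_predP : submod_closed ideal_pred.
Proof.
split; first exact/asboolP/ideal0.
by move=> c x y /asboolP Ix /asboolP Iy; apply/asboolP/idealP.
Qed.

HB.instance Definition _ :=
  GRing.isSubmodClosed.Build F A ideal_pred ideal_predP.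

Definition ideal_alg := {x : A | ideal_pred x}.

HB.instance Definition _ := SubChoice.on ideal_alg.
HB.instance Definition _ := [SubChoice_isSubLmodule of ideal_alg by <:].

Implicit Types x y z : ideal_alg.

Fact ideal_alg_mul_subproof x y : ideal_pred (val x ** val y).
Proof. by apply/asboolP/ideal_mulr/asboolP/(valP x). Qed.

Definition ideal_alg_mul x y : ideal_alg :=
  Sub (val x ** val y) (ideal_alg_mul_subproof x y).

Fact ideal_alg_mul_linl y : linear (ideal_alg_mul^~ y).
Proof.
by move=> c u v; apply/val_inj/nmul_linearl.
Qed.
Fact ideal_alg_mul_linr x : linear (ideal_alg_mul x).
Proof.
by move=> c u v; apply/val_inj/nmul_linearr.
Qed.
Fact ideal_alg_mul_lsym x y z :
  ideal_alg_mul (ideal_alg_mul x y) z - ideal_alg_mul x (ideal_alg_mul y z) =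
  ideal_alg_mul (ideal_alg_mul y x) z - ideal_alg_mul y (ideal_alg_mul x z).
Proof. by apply/val_inj/nmul_lsym. Qed.
Fact ideal_alg_mul_rcomm x y z :
  ideal_alg_mul (ideal_alg_mul x y) z = ideal_alg_mul (ideal_alg_mul x z) y.
Proof. by apply/val_inj/nmul_rcomm. Qed.

HB.instance Definition _ := Lmodule_isNovikov.Build F ideal_alg
  ideal_alg_mul_linl ideal_alg_mul_linr
  ideal_alg_mul_lsym ideal_alg_mul_rcomm.

End IdealAlgebra.

Section Quasikernel.
Variables (F : fieldType) (A : novikovType F) (M : lmodType F).
Variable rho : {linear A -> endo M}.
Local Open Scope classical_set_scope.

(* The union of all ideals contained in the kernel; the lemmas below show that
   it is the largest such ideal. *)
Definition quasikernel_set : set A :=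
  [set a | exists2 I : ideal A, I `<=` rep_ker rho & ideal_set I a].

Fact quasikernel0 : quasikernel_set 0.
Proof.
have h0 : forall c (x y : A), [set 0] x -> [set 0] y -> [set 0] (c *: x + y).
  by move=> c x y -> ->; rewrite /= scaler0 addr0.
have hl : forall a x : A, [set 0] x -> [set 0] (a ** x).
  by move=> a x ->; exact: (linear0 (nmul a)).
have hr : forall x a : A, [set 0] x -> [set 0] (x ** a).
  by move=> x a ->; exact: (linear0 (nmulr a)).
by exists (Ideal (erefl : [set 0] (0 : A)) h0 hl hr) => // a ->; apply: linear0.
Qed.

Section SumIdeal.
Variables I J : ideal A.
Let S : set A := [set z | exists x y, [/\ ideal_set I x, ideal_set J y & z = x + y]].
Let S0 : S 0.
Proof. by exists 0, 0; rewrite addr0; split=> //; apply: ideal0. Qed.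
Let SP (c : F) x y : S x -> S y -> S (c *: x + y).
Proof.
move=> [x1 [x2 [Ix1 Jx2 ->]]] [y1 [y2 [Iy1 Jy2 ->]]].
exists (c *: x1 + y1), (c *: x2 + y2).
by split; [exact: idealP | exact: idealP | rewrite scalerDr addrACA].
Qed.
Let Sl a x : S x -> S (a ** x).
Proof.
move=> [x1 [x2 [Ix1 Jx2 ->]]]; exists (a ** x1), (a ** x2).
by split; [exact: ideal_mull | exact: ideal_mull | rewrite linearD].
Qed.
Let Sr x a : S x -> S (x ** a).
Proof.
move=> [x1 [x2 [Ix1 Jx2 ->]]]; exists (x1 ** a), (x2 ** a).
split; [exact: ideal_mulr | exact: ideal_mulr |].
exact: (linearD (nmulr a)).
Qed.
Definition sum_ideal : ideal A := Ideal S0 SP Sl Sr.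
End SumIdeal.

Fact quasikernelP c x y :
  quasikernel_set x -> quasikernel_set y -> quasikernel_set (c *: x + y).
Proof.
move=> [I IK Ix] [J JK Jy]; exists (sum_ideal I J).
  move=> _ [u [v [/IK Ku /JK Kv ->]]].
  by rewrite /rep_ker /= linearD Ku Kv addr0.
exists (c *: x), y; split=> //.
by rewrite -[c *: x]addr0; apply: idealP => //; apply: ideal0.
Qed.

Fact quasikernel_mull a x : quasikernel_set x -> quasikernel_set (a ** x).
Proof. by move=> [I IK Ix]; exists I => //; apply: ideal_mull. Qed.

Fact quasikernel_mulr x a : quasikernel_set x -> quasikernel_set (x ** a).
Proof. by move=> [I IK Ix]; exists I => //; apply: ideal_mulr. Qed.

Definition quasikernel : ideal A :=
  Ideal quasikernel0 quasikernelP quasikernel_mull quasikernel_mulr.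

Lemma quasikernel_sub : quasikernel `<=` rep_ker rho.
Proof. by move=> a [I IK /IK]. Qed.

Lemma quasikernel_max (I : ideal A) :
  I `<=` rep_ker rho -> I `<=` quasikernel.
Proof. by move=> IK a Ia; exists I. Qed.

End Quasikernel.

Definition in_classJ (F : fieldType) (A : novikovType F) : Prop :=
  forall (M : lmodType F) (rho : {linear A -> endo M}), ~ irreducible_rep rho.

Definition is_jacobson_radical (F : fieldType) (A : novikovType F)
    (J : ideal A) : Prop :=
  in_classJ (ideal_alg J) /\
  forall I : ideal A, in_classJ (ideal_alg I) -> (I `<=` J)%classic.

(* Main.v *)
(* Put D(f,g) = rho(fg) - rho(f)rho(g).  In every right Novikov representation
   the operators rho(a) commute, D(fh,g) = D(f,g)rho(h), and
   D(f,g)D(h,k) = D(h,g)D(f,k).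
   If an ideal I acts nontrivially on an irreducible module M, then M is
   irreducible over I: for n <> 0 in an I-submodule N, one of n D(I,j) (j in I)
   and n rho(I) is a nonzero A-submodule contained in N.
   Conversely, let M be an irreducible module of an ideal J.  By the second
   identity x |-> m D(x,g), or x |-> m rho(x) when D = 0, is a J-linear map of J
   onto M.  Some e in J T(J) acts on M as the identity, so J(1-e) <> J; as
   J(1-e) is an A-submodule of J, a maximal right ideal of T(A) above
   {w | x w in J(1-e)} gives an irreducible A-module on which e acts as 1, hence
   on which J acts nontrivially. *)
From HB Require Import structures.
Require Import Defs.
From mathcomp Require Import all_boot all_order all_algebra.
From mathcomp Require Import generic_quotient ring_quotient.
From mathcomp Require Import boolp classical_sets.

Set Implicit Arguments.
Unset Strict Implicit.
Unset Printing Implicit Defensive.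
Local Open Scope ring_scope.

Import GRing.Theory Quotient.

(** * Quotients of vector spaces *)

Section QuotientModule.
Variables (F : fieldType) (V : lmodType F) (S : zmodClosed V).
Hypothesis SZ : forall c x, x \in S -> c *: x \in S.

(* The unused argument lets the module structure be inferred from the type. *)
Definition quotmod of (forall c x, x \in S -> c *: x \in S) := {quot S}.
Local Notation Q := (quotmod SZ).
HB.instance Definition _ := GRing.Zmodule.on Q.

Definition quot_pi (x : V) : Q := \pi_({quot S})%qT x.

Lemma quot_piK (x : Q) : quot_pi (repr x) = x.
Proof. exact: reprK. Qed.

Lemma quot_piD x y : quot_pi (x + y) = quot_pi x + quot_pi y.
Proof. exact: pi_add. Qed.

Lemma quot_pi_eq x y : (quot_pi x == quot_pi y) = (x - y \in S).
Proof. by rewrite idealrBE. Qed.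

Definition quot_scale (c : F) (x : Q) : Q := quot_pi (c *: repr x).

Lemma quot_piZ (c : F) x : quot_pi (c *: x) = quot_scale c (quot_pi x).
Proof.
apply/eqP; rewrite quot_pi_eq -scalerBr SZ // -quot_pi_eq.
by rewrite quot_piK.
Qed.

Fact quot_scaleA c d x : quot_scale c (quot_scale d x) = quot_scale (c * d) x.
Proof. by rewrite -[x]quot_piK -!quot_piZ scalerA. Qed.
Fact quot_scale1 : left_id 1 quot_scale.
Proof. by move=> x; rewrite -[x]quot_piK -quot_piZ scale1r. Qed.
Fact quot_scaleDr : right_distributive quot_scale +%R.
Proof.
move=> c x y; rewrite -[x]quot_piK -[y]quot_piK.
by rewrite -quot_piD -!quot_piZ scalerDr quot_piD.
Qed.
Fact quot_scaleDl x : {morph quot_scale^~ x : c d / c + d}.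
Proof.
by move=> c d /=; rewrite -[x]quot_piK -!quot_piZ scalerDl quot_piD.
Qed.

HB.instance Definition _ := GRing.Zmodule_isLmodule.Build F Q
  quot_scaleA quot_scale1 quot_scaleDr quot_scaleDl.

Fact quot_pi_linear : linear quot_pi.
Proof. by move=> c x y; rewrite quot_piD quot_piZ. Qed.
HB.instance Definition _ := GRing.isLinear.Build F V Q _ quot_pi
  quot_pi_linear.

Lemma quot_pi_eq0 x : (quot_pi x = 0) <-> x \in S.
Proof.
by rewrite -(subr0 x) -quot_pi_eq subr0 linear0; split=> [->|/eqP].
Qed.

End QuotientModule.

(** * Operators induced by elements of the tensor algebra *)

Section TensorAction.
Variable F : fieldType.

Lemma tlift_comp (V W M : lmodType F) (h : {linear V -> W})
    (g : {linear W -> endo M}) (w : tensor V) :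
  tlift g (tlift (@tin F W \o h) w) = tlift (g \o h) w.
Proof.
elim/tpi_ind: w; elim=> [v|||s IHs t IHt|c t IHt|s IHs t IHt].
- by rewrite !tlift_in.
- by rewrite !linear0.
- by rewrite !tlift1.
- by rewrite tpiD !linearD /= IHs IHt.
- by rewrite tpiZ !linearZ /= IHt.
- by rewrite tpiM !tliftM IHs IHt.
Qed.

Section TensorActionE.
Variables (V M : lmodType F) (f : {linear V -> endo M}).

Lemma tliftE0 m : tlift f 0 m = 0. Proof. by rewrite linear0. Qed.
Lemma tliftE1 m : tlift f 1 m = m. Proof. by rewrite tlift1. Qed.
Lemma tliftED u v m : tlift f (u + v) m = tlift f u m + tlift f v m.
Proof. by rewrite linearD. Qed.
Lemma tliftEB u v m : tlift f (u - v) m = tlift f u m - tlift f v m.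
Proof. by rewrite linearB. Qed.
Lemma tliftEZ c u m : tlift f (c *: u) m = c *: tlift f u m.
Proof. by rewrite linearZ. Qed.
Lemma tliftEM u v m : tlift f (u * v) m = tlift f v (tlift f u m).
Proof. by rewrite tliftM. Qed.
Lemma tliftE_in v m : tlift f (tin v) m = f v m.
Proof. by rewrite tlift_in. Qed.

End TensorActionE.

Lemma tlift_intertwine (V M N : lmodType F) (f : {linear V -> endo M})
    (g : {linear V -> endo N}) (phi : {linear M -> N}) :
    (forall v m, phi (f v m) = g v (phi m)) ->
  forall w m, phi (tlift f w m) = tlift g w (phi m).
Proof.
move=> fg; elim/tpi_ind; elim=> [v|||s IHs t IHt|c t IHt|s IHs t IHt] m.
- by rewrite !tliftE_in.
- by rewrite !tliftE0 linear0.
- by rewrite !tliftE1.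
- by rewrite tpiD !tliftED linearD IHs IHt.
- by rewrite tpiZ !tliftEZ linearZ /= IHt.
- by rewrite tpiM !tliftEM IHt IHs.
Qed.

End TensorAction.

(** * Submodules, maximality and quotient representations *)

Section Submodules.
Variables (F : fieldType) (A : novikovType F) (M : lmodType F).
Variable rho : {linear A -> endo M}.
Implicit Types N : set M.
Local Open Scope classical_set_scope.

Lemma submoduleB N x y : submodule rho N -> N x -> N y -> N (x - y).
Proof. by case=> _ NP _ Nx Ny; rewrite addrC -scaleN1r; exact: NP. Qed.

Lemma submoduleD N x y : submodule rho N -> N x -> N y -> N (x + y).
Proof. by case=> _ NP _ Nx Ny; rewrite -[x]scale1r; exact: NP. Qed.

Lemma submodule_tlift N w x : submodule rho N -> N x -> N (tlift rho w x).
Proof.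
move=> [N0 NP NA]; move: x.
elim/tpi_ind: w; elim=> [v|||s IHs t IHt|c t IHt|s IHs t IHt] x Nx.
- by rewrite tliftE_in; exact: NA.
- by rewrite tliftE0.
- by rewrite tliftE1.
- rewrite tpiD tliftED -[tlift rho (tpi s) x]scale1r.
  by apply: NP; [exact: IHs|exact: IHt].
- by rewrite tpiZ tliftEZ -[_ *: _]addr0; apply: NP => //; exact: IHt.
- by rewrite tpiM tliftEM; apply: IHt; exact: IHs.
Qed.

(** The map [g] need not be a homomorphism: in the restriction argument [j] is sometimes [i ** a]
    and sometimes [a ** i]. *)
Lemma submodule_ideal_image (I : ideal A) (g : A -> M) : linear g ->
    (forall i a, ideal_set I i ->
      exists2 j, ideal_set I j & rho a (g i) = g j) ->
  submodule rho (g @` I).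
Proof.
move=> gl gA; split.
- exists 0; first exact: ideal0.
  by have := gl (-1) 0 0; rewrite !scaleN1r !addNr.
- move=> c _ _ [x Ix <-] [y Iy <-]; exists (c *: x + y); rewrite ?gl //.
  exact: idealP.
- by move=> _ a [x Ix <-]; have [y Iy ->] := gA x a Ix; exists y.
Qed.

Lemma tlift_mapP x : submodule rho [set tlift rho w x | w in setT].
Proof.
split.
- by exists 0 => //; rewrite tliftE0.
- move=> c _ _ [u _ <-] [v _ <-]; exists (c *: u + v) => //.
  by rewrite tliftED tliftEZ.
- move=> _ a [u _ <-]; exists (u * tin a) => //.
  by rewrite tliftEM tliftE_in.
Qed.

Lemma maximal_submodule N0 v : submodule rho N0 -> ~ N0 v ->
  exists N, [/\ submodule rho N, N0 `<=` N, ~ N v &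
    forall N', submodule rho N' -> N `<=` N' -> ~ N' v -> N' = N].
Proof.
move=> sN0 N0v.
pose good N := [/\ submodule rho N, N0 `<=` N & ~ N v].
(* The empty chain has empty union, which is not good, so Zorn's lemma is applied to sets that are
   good if nonempty. A maximal one is nonempty because [N0] is good. *)
have [|N [gN maxN]] := @Zorn_bigcup _ [set N | N !=set0 -> good N].
  move=> C Cgood Ctot [x0 [N CN Nx0]].
  have gC K x : C K -> K x -> good K.
    by move=> CK Kx; apply: Cgood => //; exists x.
  have [[N_0 NP NA] N0N _] := gC _ _ CN Nx0.
  split; first split.
  - by exists N.
  - move=> c x y [K CK Kx] [K' CK' K'y].
    have [[_ KP _] _ _] := gC _ _ CK Kx.
    have [[_ K'P _] _ _] := gC _ _ CK' K'y.
    have [KK'|K'K] := Ctot _ _ CK CK'.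
    + by exists K' => //; apply: K'P => //; exact: KK'.
    + by exists K => //; apply: KP => //; exact: K'K.
  - move=> x a [K CK Kx]; exists K => //.
    by have [[_ _ KA] _ _] := gC _ _ CK Kx; exact: KA.
  - by move=> x N0x; exists N => //; exact: N0N.
  - by move=> [K CK Kv]; have [_ _ /(_ Kv)] := gC _ _ CK Kv.
have [sN NN Nv] : good N.
  apply: gN; apply: contrapT => Ne; apply: (maxN N0) => [|_]; last by split.
  split => [x Nx|N0N]; first by case: Ne; exists x.
  by apply: Ne; exists 0; apply: N0N; case: sN0.
exists N; split => // N' sN' NN' N'v; apply: contrapT => neq.
apply: (maxN N'); last by split => // x /NN /NN'.
by split => // N'N; apply: neq; rewrite eqEsubset.
Qed.

Lemma quotient_rep N : submodule rho N ->
  exists (Q : lmodType F) (tau : {linear A -> endo Q}) (p : {linear M -> Q}),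
    [/\ forall y, exists x, p x = y, forall x, p x = 0 <-> N x &
        forall a x, p (rho a x) = tau a (p x)].
Proof.
move=> sN; have [N0 NP NA] := sN.
pose P : {pred M} := fun x => `[< N x >].
have PP : zmod_closed P.
  split; first exact/asboolP.
  move=> x y /asboolP Nx /asboolP Ny; apply/asboolP.
  exact: submoduleB sN Nx Ny.
pose S : zmodClosed M := HB.pack P (GRing.isZmodClosed.Build M P PP).
have SZ c x : x \in S -> c *: x \in S.
  by move=> /asboolP Nx; apply/asboolP; rewrite -[_ *: _]addr0; exact: NP.
pose p : {linear M -> quotmod SZ} := @quot_pi F M S SZ.
have p0 x : p x = 0 <-> N x.
  split; first by move/quot_pi_eq0/asboolP.
  by move=> Nx; apply/quot_pi_eq0/asboolP.
pose act a (y : quotmod SZ) := p (rho a (repr y)).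
have actE a x : p (rho a x) = act a (p x).
  apply/eqP; rewrite -subr_eq0 -linearB -linearB; apply/eqP/p0/NA/p0.
  by rewrite linearB /= quot_piK subrr.
have actl a : linear (act a).
  move=> c x y; rewrite -(quot_piK x) -(quot_piK y) -!/(p _) -linearP.
  by rewrite -!actE !linearP.
pose tau a : endo (quotmod SZ) := mk_endo (actl a).
have taul : linear tau.
  move=> c a b; apply: endo_eq => x; rewrite endoDE endoZE /=.
  by rewrite -(quot_piK x) -!/(p _) -!actE linearP endoDE endoZE linearP.
pose taulin : {linear A -> endo (quotmod SZ)} :=
  HB.pack tau (GRing.isLinear.Build F A _ _ tau taul).
exists (quotmod SZ), taulin, p.
split => // y; exists (repr y); exact: quot_piK.
Qed.

End Submodules.

(** * Associator identities in a Novikov algebra *)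

Section NovikovIdentities.
Variables (F : fieldType) (A : novikovType F).
Implicit Types x y z w : A.

Definition nassoc x y z := (x ** y) ** z - x ** (y ** z).

Lemma nmulNl x y : - x ** y = - (x ** y).
Proof. exact: (linearN (nmulr y)). Qed.
Lemma nmulBl x y z : (x - y) ** z = x ** z - y ** z.
Proof. exact: (linearB (nmulr z)). Qed.

Lemma nassocC x y z : nassoc x y z = nassoc y x z.
Proof. exact: nmul_lsym. Qed.

(** Right multiplications commute, so [w] moves to the end of both terms. *)
Lemma nassoc_mull x w y z : nassoc (x ** w) y z = nassoc x y z ** w.
Proof.
rewrite /nassoc nmulBl (nmul_rcomm x w y) (nmul_rcomm (x ** y) w).
by rewrite (nmul_rcomm x w).
Qed.

Lemma nassocBl x x' y z : nassoc (x - x') y z = nassoc x y z - nassoc x' y z.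
Proof. by rewrite /nassoc !nmulBl !opprD !opprK addrACA. Qed.

Lemma nassocNl x y z : nassoc (- x) y z = - nassoc x y z.
Proof. by rewrite /nassoc !nmulNl opprD. Qed.

(** Both sides apply to [u] two operators that are combinations of right multiplications, and such
    operators commute. *)
Lemma nassoc_nassocAC u v w y z :
  nassoc (nassoc u v w) y z = nassoc (nassoc u y z) v w.
Proof. by rewrite {2}/nassoc nassocBl !nassoc_mull. Qed.

(** Alternate left symmetry with the previous lemma: ((x,f,g),h,k) = ((f,x,g),h,k) = ((f,h,k),x,g) =
    ((h,f,k),x,g) = ((h,x,g),f,k). *)
Lemma nassoc_nassoc_swap x f g h k :
  nassoc (nassoc x f g) h k = nassoc (nassoc x h g) f k.
Proof.
rewrite (nassocC x f) nassoc_nassocAC (nassocC f h) nassoc_nassocAC.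
by rewrite (nassocC h x).
Qed.

(** This is D(x,y). In the right regular representation it is an associator up to sign, so
    associator identities yield identities for D. *)
Definition defect (M : lmodType F) (rho : {linear A -> endo M}) x y : endo M :=
  rho (x ** y) - rho x * rho y.

Lemma defect_rmultE x y z : defect (@rmult F A) x y z = - nassoc z x y.
Proof. by rewrite /defect endoDE endoNE endoME opprB. Qed.

End NovikovIdentities.

(** * The right regular representation *)

Section RegularRepresentation.
Variable F : fieldType.

Lemma nsubst_fresh (v : freeNovikov F) : exists n, forall (A : novikovType F)
  (a b : nat -> A), (forall i, i < n -> a i = b i)%N -> nsubst a v = nsubst b v.
Proof.
elim/npi_ind: v; elim=> [i||s [n IHs] t [p IHt]|c t [n IHt]|
  s [n IHs] t [p IHt]].
- by exists i.+1 => A a b ab; rewrite !nsubst_var ab.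
- by exists 0%N => A a b _; rewrite !linear0.
- exists (maxn n p) => A a b ab; rewrite npiD !linearD /=.
  by rewrite (IHs _ a b) ?(IHt _ a b) // => i lti; apply: ab;
    rewrite leq_max lti ?orbT.
- by exists n => A a b ab; rewrite npiZ !linearZ /= (IHt _ a b).
- exists (maxn n p) => A a b ab; rewrite npiM !nsubstM.
  by rewrite (IHs _ a b) ?(IHt _ a b) // => i lti; apply: ab;
    rewrite leq_max lti ?orbT.
Qed.

(** Only finitely many generators occur in [G], so a later one may be sent anywhere. *)
Lemma tsubst_fresh (G : tensor (freeNovikov F)) :
  exists n, forall (A : novikovType F) (a b : nat -> A),
  (forall i, i < n -> a i = b i)%N -> tsubst a G = tsubst b G.
Proof.
elim/tpi_ind: G; elim=> [v|||s [n IHs] t [p IHt]|c t [n IHt]|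
  s [n IHs] t [p IHt]].
- have [n nP] := nsubst_fresh v; exists n => A a b ab.
  by rewrite /tsubst !tlift_in /= (nP _ a b).
- by exists 0%N => A a b _; rewrite /tsubst !linear0.
- by exists 0%N => A a b _; rewrite /tsubst !tlift1.
- exists (maxn n p) => A a b ab;
  rewrite tpiD /tsubst !linearD /= -!/(tsubst _ _).
  by rewrite (IHs _ a b) ?(IHt _ a b) // => i lti; apply: ab;
    rewrite leq_max lti ?orbT.
- exists n => A a b ab.
  by rewrite tpiZ /tsubst !linearZ /= -!/(tsubst _ _) (IHt _ a b).
- exists (maxn n p) => A a b ab; rewrite tpiM /tsubst !tliftM -!/(tsubst _ _).
  by rewrite (IHs _ a b) ?(IHt _ a b) // => i lti; apply: ab;
    rewrite leq_max lti ?orbT.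
Qed.

Lemma tlift_tsubst (A : novikovType F) (M : lmodType F)
    (rho : {linear A -> endo M}) (a : nat -> A) G :
  tlift rho (tsubst a G) = tlift (rho \o nsubst a) G.
Proof. exact: tlift_comp. Qed.

(** An R-identity annihilates the free algebra, in particular a generator not occurring in it.
    Sending that generator to [m] carries this to the vanishing of G(a) on [m]. *)
Lemma rmult_right_novikov (A : novikovType F) :
  right_novikov_rep (@rmult F A).
Proof.
move=> G GR a; apply: endo_eq => m.
have [n nP] := tsubst_fresh G.
pose b i := if (i < n)%N then a i else m.
rewrite (nP _ a b) => [|i lti]; last by rewrite /b lti.
have <- : nsubst b (nvar F n) = m by rewrite nsubst_var /b ltnn.
rewrite tlift_tsubst -(@tlift_intertwine _ _ _ _ (@rmult F (freeNovikov F))).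
  by rewrite GR linear0.
by move=> v x; exact: nsubstM.
Qed.

End RegularRepresentation.

(** * Operator identities in right Novikov representations *)

Section RightNovikovIdentities.
Variables (F : fieldType) (A : novikovType F) (M : lmodType F).
Variable rho : {linear A -> endo M}.
Hypothesis rhoN : right_novikov_rep rho.

(** Operator identities need only be checked on right multiplications of the free algebra. The list
    [s] gives the values of the first generators; the others go to 0. *)
Lemma right_novikov_eq (s : seq A) (G H : tensor (freeNovikov F)) :
    tlift (@rmult F (freeNovikov F)) G = tlift (@rmult F (freeNovikov F)) H ->
  tlift (rho \o nsubst (nth 0 s)) G = tlift (rho \o nsubst (nth 0 s)) H.
Proof.
move=> GH; apply/eqP; rewrite -subr_eq0 -linearB /= -tlift_tsubst; apply/eqP.
by apply: rhoN; rewrite /R_identity linearB /= GH subrr.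
Qed.

Let x i := tin (nvar F i).
Let tdefect (u v : freeNovikov F) := tin (u ** v) - tin u * tin v.

Let tlift_defect (B : novikovType F) (N : lmodType F)
    (tau : {linear B -> endo N}) (a : nat -> B) u v :
  tlift (tau \o nsubst a) (tdefect u v) = defect tau (nsubst a u) (nsubst a v).
Proof. by rewrite linearB /= tliftM !tlift_in /= nsubstM. Qed.

Let tlift_rmult_defect u v : tlift (@rmult F (freeNovikov F)) (tdefect u v) =
  defect (@rmult F (freeNovikov F)) u v.
Proof. by rewrite linearB /= tliftM !tlift_in. Qed.

Lemma rep_mulC f g : rho f * rho g = rho g * rho f.
Proof.
have := @right_novikov_eq [:: f; g] (x 0%N * x 1%N) (x 1%N * x 0%N).
rewrite !tliftM !tlift_in /= !nsubst_var; apply; apply: endo_eq => m.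
exact: nmul_rcomm.
Qed.

(** On the free algebra: (m,fh,g) = (fh,m,g) = (f,m,g)h = (m,f,g)h. *)
Lemma defect_mull f h g : defect rho (f ** h) g = defect rho f g * rho h.
Proof.
pose v i := nvar F i.
have := @right_novikov_eq [:: f; g; h] (tdefect (v 0%N ** v 2%N) (v 1%N))
  (tdefect (v 0%N) (v 1%N) * x 2%N).
rewrite !tliftM !tlift_in !tlift_defect !tlift_rmult_defect /= nsubstM.
rewrite !nsubst_var; apply; apply: endo_eq => m.
rewrite endo_amulE endoME !defect_rmultE /= /nmulr.
by rewrite (nassocC m) nassoc_mull nassocC nmulNl.
Qed.

Lemma defect_swap f g h k :
  defect rho f g * defect rho h k = defect rho h g * defect rho f k.
Proof.
pose v i := nvar F i.
have := @right_novikov_eq [:: f; g; h; k]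
  (tdefect (v 0%N) (v 1%N) * tdefect (v 2%N) (v 3%N))
  (tdefect (v 2%N) (v 1%N) * tdefect (v 0%N) (v 3%N)).
rewrite !tliftM !tlift_defect !tlift_rmult_defect /= !nsubst_var; apply.
apply: endo_eq => m; rewrite !endo_amulE !endoME !defect_rmultE.
by rewrite !nassocNl nassoc_nassoc_swap.
Qed.

End RightNovikovIdentities.

(** * Schur-type injectivity in irreducible modules *)

Section IrreducibleReps.
Variables (F : fieldType) (A : novikovType F) (M : lmodType F).
Variable rho : {linear A -> endo M}.
Hypothesis rhoI : irreducible_rep rho.
Local Open Scope classical_set_scope.

Lemma irreducible_right_novikov : right_novikov_rep rho.
Proof. by case: rhoI. Qed.

Lemma irreducible_full N m : submodule rho N -> N m -> m != 0 -> N = setT.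
Proof.
move=> sN Nm m0; have [_ /(_ N sN) [N0|//] _] := rhoI.
by move: Nm m0; rewrite N0 => ->; rewrite eqxx.
Qed.

(** The kernel of [f] is a submodule; were a nonzero [m] in it, it would be everything. *)
Lemma commuting_inj (f : endo M) m : (forall a, rho a * f = f * rho a) ->
  f != 0 -> m != 0 -> f m != 0.
Proof.
move=> fC f0 m0; apply: contra f0 => /eqP fm; apply/eqP/endo_eq => x.
have kerf : submodule rho [set y | f y = 0].
  split=> [|c y z|y a] /=; first exact: linear0.
  - by move=> fy fz; rewrite linearP fy fz scaler0 addr0.
  - by move=> fy; rewrite -endoME fC endoME fy linear0.
by have /seteqP [_ /(_ x I)] := irreducible_full kerf fm m0.
Qed.

Lemma defectC a f g : rho a * defect rho f g = defect rho f g * rho a.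
Proof.
have rC := rep_mulC irreducible_right_novikov.
rewrite /defect mulrBr mulrBl (rC a (f ** g)); congr (_ - _).
by rewrite mulrA (rC a f) -mulrA (rC a g) mulrA.
Qed.

Lemma rep_inj a m : rho a != 0 -> m != 0 -> rho a m != 0.
Proof.
by apply: commuting_inj => b; apply: rep_mulC irreducible_right_novikov _ _.
Qed.

Lemma defect_inj f g m : defect rho f g != 0 -> m != 0 -> defect rho f g m != 0.
Proof. by apply: commuting_inj => b; exact: defectC. Qed.

End IrreducibleReps.

(** * Restriction of irreducible representations to ideals *)

Section Restriction.
Variables (F : fieldType) (A : novikovType F) (I : ideal A) (M : lmodType F).
Variable rho : {linear A -> endo M}.
Local Open Scope classical_set_scope.

Definition restr_rep : {linear ideal_alg I -> endo M} := rho \o val.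

Lemma ideal_algP (x : ideal_alg I) : ideal_set I (val x).
Proof. exact/asboolP/(valP x). Qed.

Lemma ideal_alg_ex x : ideal_set I x -> exists y : ideal_alg I, val y = x.
Proof. by move=> /asboolP Ix; exists (exist _ x Ix). Qed.

Lemma restr_right_novikov :
  right_novikov_rep rho -> right_novikov_rep restr_rep.
Proof.
move=> rhoN G GR a; rewrite -[RHS](rhoN G GR (val \o a)) !tlift_tsubst.
pose v : {linear ideal_alg I -> A} := val.
have va : (v \o nsubst a : {linear _ -> _}) =1 nsubst (val \o a).
  apply: nsubst_unique => [x y|i] /=; first by rewrite nsubstM.
  by rewrite nsubst_var.
apply: endo_eq => m.
apply: (@tlift_intertwine _ _ _ _ _ _ (idfun : {linear M -> M})) => f x /=.
by rewrite -va.
Qed.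

Lemma restr_irreducible : irreducible_rep rho ->
  (exists2 i, ideal_set I i & rho i != 0) -> irreducible_rep restr_rep.
Proof.
move=> rhoI [i0 Ii0 rhoi0]; have [rhoN _ [m0 [a0 ma0]]] := rhoI.
have m0n0 : m0 != 0 by apply: contra ma0 => /eqP ->; rewrite linear0.
split.
- exact: restr_right_novikov.
- move=> N [N0 NP NI].
  have [[n Nn n0]|Ne] := pselect (exists2 n, N n & n != 0); last first.
    left; apply/seteqP; split=> [x Nx|_ -> //].
    by apply: contrapT => /eqP x0; apply: Ne; exists x.
  right; have {}NI i x : ideal_set I i -> N x -> N (rho i x).
    by move=> /ideal_alg_ex [j <-] Nx; exact: NI.
  (* Then g(I) is a nonzero A-submodule inside [N], hence all of M. *)
  suff [g [gl gI gN [i Ii gi0]]] : exists g : A -> M, [/\ linear g,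
      forall i a, ideal_set I i -> exists2 j, ideal_set I j & rho a (g i) = g j,
      forall i, ideal_set I i -> N (g i) & exists2 i, ideal_set I i & g i != 0].
    have gfull : (g @` I) = setT.
      apply: (irreducible_full rhoI (submodule_ideal_image gl gI) _ gi0).
      by exists i.
    apply/seteqP; split=> // x _; have [y Iy <-] : (g @` I) x by rewrite gfull.
    exact: gN.
  have [[i [j [Ii Ij Dij]]]|D0] := pselect
    (exists i j, [/\ ideal_set I i, ideal_set I j & defect rho i j != 0]).
    exists (fun x => defect rho x j n); split.
    + move=> c x y; rewrite /defect !endoDE !endoNE !endoME nmul_linearl.
      by rewrite !linearP /= addrACA -scalerDr.
    + move=> x a Ix; exists (x ** a); first exact: ideal_mulr.
      by rewrite defect_mull.
    (* Both terms of n D(x,j) come from [n] by acting with elements of [I]. *)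
    + move=> x Ix; rewrite /defect endoDE endoNE endoME addrC -scaleN1r.
      by apply: NP; apply: (NI) => //; [exact: NI|exact: ideal_mulr].
    + by exists i => //; exact: defect_inj.
  have {}D0 i j : ideal_set I i -> ideal_set I j -> defect rho i j = 0.
    by move=> Ii Ij; apply: contrapT => /eqP Dij; apply: D0; exists i, j.
  exists (fun x => rho x n); split.
  + by move=> c x y; rewrite linearP.
  + suff rhoIA i a : ideal_set I i ->
        rho i * rho a = rho (i ** a) \/ rho i * rho a = rho (a ** i).
      move=> i a Ii; rewrite -endoME; have [->|->] := rhoIA i a Ii.
      * by exists (i ** a) => //; exact: ideal_mulr.
      * by exists (a ** i) => //; exact: ideal_mull.
    move=> Ii; have [Dia|/eqP Dia] := pselect (defect rho i a = 0).
      by left; move/eqP: Dia; rewrite subr_eq0 => /eqP.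
    (* If D(i,a) and D(a,i) were both nonzero, their product would be nonzero by injectivity; yet
       D(a,i)D(i,a) = D(i,i)D(a,a) = 0. *)
    right; rewrite (rep_mulC rhoN); apply/esym/eqP; rewrite -subr_eq0.
    rewrite -[_ - _]/(defect rho a i); apply: contraPT isT => Dai.
    have Daim : defect rho a i m0 != 0 by exact: defect_inj.
    have := defect_inj rhoI Dia Daim; rewrite -endoME.
    by rewrite defect_swap // (D0 i i) // mul0r eqxx.
  + by move=> i Ii; exact: NI.
  + by exists i0 => //; exact: rep_inj.
- have [j ji0] := ideal_alg_ex Ii0.
  by exists m0, j; rewrite /= ji0; exact: rep_inj.
Qed.

End Restriction.

(** * Maps from the regular module and operators acting as the identity *)

Section IrreducibleModules.
Variables (F : fieldType) (A : novikovType F) (M : lmodType F).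
Variable rho : {linear A -> endo M}.
Hypothesis rhoI : irreducible_rep rho.
Local Open Scope classical_set_scope.

(** This moves questions about M to the regular module, which for an ideal sits inside the ambient
    algebra. *)
Lemma irreducible_cover : exists phi : {linear A -> M},
  (forall x h, phi (x ** h) = rho h (phi x)) /\ exists x, phi x != 0.
Proof.
have [rhoN _ [m [a am]]] := rhoI.
have [[f [g Dfg]]|D0] := pselect (exists f g, defect rho f g != 0).
  have {am} m0 : m != 0 by apply: contra am => /eqP ->; rewrite linear0.
  pose phi x := defect rho x g m.
  have phil : linear phi.
    move=> c x y; rewrite /phi /defect !endoDE !endoNE !endoME nmul_linearl.
    by rewrite !linearP /= addrACA -scalerDr.
  pose philin : {linear A -> M} :=
    HB.pack phi (GRing.isLinear.Build F A M _ phi phil).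
  exists philin.
  split=> [x h|]; first by rewrite /= /phi defect_mull.
  by exists f; exact: defect_inj.
pose phi x := rho x m.
have phil : linear phi by move=> c x y; rewrite /phi linearP.
pose philin : {linear A -> M} :=
  HB.pack phi (GRing.isLinear.Build F A M _ phi phil).
exists philin.
split=> [x h|]; last by exists a.
rewrite /= /phi -endoME.
suff -> : rho (x ** h) = rho x * rho h by [].
apply/eqP; rewrite -subr_eq0; apply: contrapT => /negP Dxh; apply: D0.
by exists x, h.
Qed.

(** A nonzero m rho(a) generates M, so some [g] returns it to [m]. The operators commute, so the
    fixed vectors of a g form a submodule; it contains [m] and is therefore M. *)
Lemma irreducible_unit : exists a g, forall m, tlift rho (tin a * g) m = m.
Proof.
have [rhoN _ [m [a am]]] := rhoI.
have : [set tlift rho w (rho a m) | w in setT] = setT.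
  apply: (irreducible_full rhoI (tlift_mapP rho (rho a m))) am.
  by exists 1 => //; rewrite tliftE1.
move=> /seteqP [_ /(_ m I) [g _ gm]].
exists a, g => x; pose fixed := [set y | tlift rho (tin a * g) y = y].
have sfixed : submodule rho fixed.
  rewrite /fixed; split=> [|c y z|y b] /=; first exact: linear0.
  - by move=> fy fz; rewrite linearP fy fz.
  - move=> fy; rewrite -[in RHS]fy.
    apply/esym/(@tlift_intertwine _ _ _ _ rho rho (rho b)) => f z.
    by rewrite -!endoME (rep_mulC rhoN).
have m0 : m != 0 by apply: contra am => /eqP ->; rewrite linear0.
have fm : fixed m by rewrite /fixed /= tliftEM tliftE_in.
by have /seteqP [_ /(_ x I)] := irreducible_full rhoI sfixed fm m0.
Qed.

End IrreducibleModules.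

(** * Irreducible quotients of the tensor algebra *)

Section RegularTensor.
Variables (F : fieldType) (A : novikovType F).
Local Open Scope classical_set_scope.

(** The submodules for this action are the right ideals of T(A). *)
Definition treg (a : A) : endo (tensor A) := mk_endo (ts_mul_linearl (tin a)).

Fact treg_linear : linear treg.
Proof.
move=> c a b; apply: endo_eq => w; rewrite endoDE endoZE /= linearP.
by rewrite mulrDr ts_scalerAr.
Qed.
HB.instance Definition _ := GRing.isLinear.Build F A (endo (tensor A)) _ treg
  treg_linear.

Lemma tlift_tregE w u : tlift treg w u = u * w.
Proof.
elim/tpi_ind: w u; elim=> [v|||s IHs t IHt|c t IHt|s IHs t IHt] u.
- by rewrite tliftE_in.
- by rewrite tliftE0 mulr0.
- by rewrite tliftE1 mulr1.
- by rewrite tpiD tliftED IHs IHt mulrDr.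
- by rewrite tpiZ tliftEZ IHt ts_scalerAr.
- by rewrite tpiM tliftEM IHt IHs mulrA.
Qed.

(** Divide T(A) by a maximal right ideal N above [W]. The condition on R-identities makes the
    quotient right Novikov. If [a] lay in N, so would a t, and then 1 = (1 - a t) + a t. *)
Lemma cyclic_irreducible_quotient (W : set (tensor A)) (t : tensor A) (a : A) :
    submodule treg W -> ~ W 1 ->
    (forall G (b : nat -> A) u, R_identity G -> W (u * tsubst b G)) ->
    W (1 - tin a * t) ->
  exists (Q : lmodType F) (tau : {linear A -> endo Q}),
    irreducible_rep tau /\ tau a != 0.
Proof.
move=> sW W1 WR Wt.
have [N [sN WN N1 Nmax]] := maximal_submodule sW W1.
have [Q [tau [p [psurj p0 pA]]]] := quotient_rep sN.
have tau0 : tau a (p 1) != 0.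
  rewrite -pA /= mul1r; apply/eqP => /p0 Na; apply: N1.
  rewrite -[1](subrK (tin a * t)); apply: (submoduleD sN); first exact: WN.
  by rewrite -tlift_tregE; exact: submodule_tlift.
exists Q, tau; split; last by apply: contra tau0 => /eqP ->.
split; last by exists (p 1), a.
- move=> G GR b; apply: endo_eq => y; have [u <-] := psurj y.
  rewrite -(tlift_intertwine pA) tlift_tregE.
  exact/p0/WN/WR.
- move=> K [K0 KP KA].
  have sK : submodule treg (p @^-1` K).
    split=> [|c x y|x b] /=; first by rewrite linear0.
    + by move=> Kx Ky; rewrite linearP; exact: KP.
    + by move=> Kx; rewrite pA; exact: KA.
  have NK : N `<=` p @^-1` K by move=> x /p0 /= ->.
  (* The class of 1 generates the quotient; if [K] misses it, maximality makes the preimage of [K]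
     equal to [N]. *)
  have [K1|K1] := pselect (K (p 1)).
    right; apply/seteqP; split=> // y _; have [u <-] := psurj y.
    by rewrite -[u]mul1r -tlift_tregE; exact: (submodule_tlift u sK).
  left; apply/seteqP; split=> [y|_ -> //]; have [u <-] := psurj y.
  move=> Ku; apply/p0; rewrite -(Nmax _ sK NK K1).
  exact: Ku.
Qed.

End RegularTensor.

(** * From irreducible modules of an ideal to those of the algebra *)

Section Induction.
Variables (F : fieldType) (A : novikovType F) (J : ideal A) (M : lmodType F).
Variable sigma : {linear ideal_alg J -> endo M}.

Lemma irreducible_extend : irreducible_rep sigma ->
  exists (Q : lmodType F) (tau : {linear A -> endo Q}) (j : ideal_alg J),
    irreducible_rep tau /\ tau (val j) != 0.
Proof.
move=> sigmaI.
have [phi [phiM [x phix]]] := irreducible_cover sigmaI.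
have [j [g unit_jg]] := irreducible_unit sigmaI.
pose e : endo (ideal_alg J) := tlift (@rmult F (ideal_alg J)) (tin j * g).
pose v : {linear ideal_alg J -> A} := val.
have phie y : phi (e y) = phi y.
  rewrite (@tlift_intertwine _ _ _ _ (@rmult F (ideal_alg J)) sigma phi) //.
  by move=> h z; exact: phiM.
have vT w y : tlift (@rmult F A) (tlift (@tin F A \o v) w) (v y) =
    v (tlift (@rmult F (ideal_alg J)) w y).
  rewrite tlift_comp; apply/esym/tlift_intertwine => // h z.
have valM (y : ideal_alg J) a : exists z : ideal_alg J, v z = v y ** a.
  have [|z zE] := @ideal_alg_ex F A J (v y ** a); last by exists z.
  exact/ideal_mulr/ideal_algP.
(* The right ideal of all w with x w in J(1-e). It is proper: [phi] vanishes on J(1-e) but not at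
   [x]. *)
pose W : set (tensor A) := [set w | exists y : ideal_alg J,
  tlift (@rmult F A) w (v x) = v (y - e y)]%classic.
suff [Q [tau [tauI tauj]]] : exists (Q : lmodType F)
    (tau : {linear A -> endo Q}), irreducible_rep tau /\ tau (v j) != 0 by exists Q, tau, j.
apply: (@cyclic_irreducible_quotient _ _ W (tlift (@tin F A \o v) g)).
- split.
  + by exists 0; rewrite tliftE0 linear0 subrr linear0.
  + move=> c w1 w2 [y1 E1] [y2 E2]; exists (c *: y1 + y2).
    by rewrite tliftED tliftEZ E1 E2 -linearP /= linearP scalerBr opprD addrACA.
  + move=> w a [y E]; rewrite /W /= tliftEM tliftE_in E.
    (* Right multiplication by [a] keeps J stable and commutes with the operator [e], so (y - y e)a
       = ya - (ya)e. *)
    have [z zE] := valM y a; exists z.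
    rewrite !linearB; congr (_ - _); first exact/esym/zE.
    rewrite -[LHS]/(rmult a (v (e y))) -[RHS]/(v (e z)) /e -!vT zE.
    apply: (@tlift_intertwine _ _ _ _ (@rmult F A) (@rmult F A) (rmult a)).
    by move=> f m; exact: nmul_rcomm.
- move=> [y]; rewrite tliftE1 => /val_inj xE.
  by move: phix; rewrite xE linearB /= phie subrr eqxx.
(* R-identities act as zero on the regular module. *)
- move=> G b u GR; exists 0.
  by rewrite tliftEM rmult_right_novikov // linear0 subrr linear0.
(* Applying 1 - j g to [x] gives x - x e. *)
- exists x; rewrite tliftEB tliftE1 linearB; congr (_ - _).
  rewrite -[RHS]/(v (e x)) /e -vT.
  by have -> : tlift (@tin F A \o v) (tin j * g) =
    tin (v j) * tlift (@tin F A \o v) g by rewrite tliftM tlift_in.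
Qed.

End Induction.

(** * The intersection of quasikernels as the radical *)

Section Radical.
Variables (F : fieldType) (A : novikovType F).
Local Open Scope classical_set_scope.

Definition quasikernels_set : set A :=
  [set a | forall (M : lmodType F) (rho : {linear A -> endo M}),
    irreducible_rep rho -> ideal_set (quasikernel rho) a].

(** Kept transparent, so that its underlying set is the intersection by conversion. *)
Definition quasikernels : ideal A.
Proof.
apply: (@Ideal _ _ quasikernels_set).
- by move=> M rho _; exact: ideal0.
- by move=> c x y Kx Ky M rho rhoI; apply: idealP; [exact: Kx|exact: Ky].
- by move=> a x Kx M rho rhoI; apply: ideal_mull; exact: Kx.
- by move=> x a Kx M rho rhoI; apply: ideal_mulr; exact: Kx.
Defined.

End Radical.

Theorem theorem5p5 (F : fieldType) (charF : 2%N \notin [pchar F])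
    (A : novikovType F) :
  exists J : ideal A,
    is_jacobson_radical J /\
    (J : set A) =
      [set a | forall (M : lmodType F) (rho : {linear A -> endo M}),
                 irreducible_rep rho -> ideal_set (quasikernel rho) a]%classic.
Proof.
exists (quasikernels A); split; last by [].
split.
(* An irreducible module of the intersection would yield an irreducible [tau] of A nonzero at some
   [j] of its quasikernel. *)
- move=> M sigma /irreducible_extend [Q [tau [j [tauI /eqP]]]]; apply.
  exact: quasikernel_sub (ideal_algP j _ _ tauI).
(* Every irreducible [rho] kills [I], for otherwise its restriction would be an irreducible
   representation of [I]. *)
- move=> I IJ a Ia M rho rhoI; apply: quasikernel_max Ia => i Ii.
  apply: contrapT => /eqP rhoi; apply: (IJ M (restr_rep I rho)).
  by apply: restr_irreducible => //; exists i.
Qed.
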